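(* Let $p,q$ be relatively prime nonzero integers and $r,s$ integers with $pr+qs=1$. Let $p_{p,q,r,s}(x,y)$, its zero set $Z\subset\mathbb{R}^2$, the subsets $Z_0,Z_1\subset Z$, the function $\tau$ on $Z_0$, the polynomials $T_n,S_n$ and the space $V_{p,q,r,s}$ be as defined in the context. If $(M,N)=(e^{uQ},e^{vR})\in V_{p,q,r,s}$ (with $Q,R\in C(\mathbf i)$, $u,v\in[0,\pi]$), then $p_{p,q,r,s}(\cos u,\cos v)=0$, and the fiber of the map $$V_{p,q,r,s}\to Z,\quad(e^{uQ},e^{vR})\mapsto(\cos u,\cos v)$$ over a point $(x,y)\in Z$ is given as follows. (1) If $|x|<1$, $|y|<1$, $(x,y)\in Z_0$, and $|\tau(x,y)|\le1$, then the fiber over $(x,y)$ is a single point, conjugate to $(e^{uQ},e^{vR})$, where $u=\arccos x$, $v=\arccos y$, $Q=\mathbf i$, $R=e^{t\mathbf k}\mathbf i$, $t=\arccos(\tau(x,y))$. The corresponding point $(\gamma,\theta)$ in the pillowcase $R(S^2,\{a,b,c,d\})$ satisfies $$\cos\gamma=-T_{2s+p}(x)T_{q-2r}(y)+\sqrt{(1-x^2)(1-y^2)}\,S_{2s+p}(x)S_{q-2r}(y)\,\tau(x,y),$$ $$\cos(\gamma-\theta)=T_p(x)T_q(y)-\sqrt{(1-x^2)(1-y^2)}\,S_p(x)S_q(y)\,\tau(x,y).$$ (2) If $|x|<1$, $|y|<1$, and $(x,y)\in Z_1$, then the fiber over $(x,y)$ is an arc conjugate to the arc $t\mapsto(e^{u\mathbf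 i},e^{ve^{t\mathbf k}\mathbf i})$, $t\in[0,\pi]$, where $u=\arccos x$, $v=\arccos y$. The image $(\gamma(t),\theta(t))$ of this path in the pillowcase satisfies $$\cos\gamma=-T_{2s+p}(x)T_{q-2r}(y)+\sqrt{(1-x^2)(1-y^2)}\,S_{2s+p}(x)S_{q-2r}(y)\cos t,$$ $$\cos(\gamma-\theta)=T_p(x)T_q(y)-\sqrt{(1-x^2)(1-y^2)}\,S_p(x)S_q(y)\cos t.$$ (3) If $|x|\le1$, $|y|\le1$, one of $|x|,|y|$ equals $1$, and $(x,y)\in Z_1$, then the fiber over $(x,y)$ is a single point. The corresponding point $(\gamma,\theta)$ in the pillowcase satisfies $$\cos\gamma=-T_{2s+p}(x)T_{q-2r}(y),\qquad\cos(\gamma-\theta)=T_p(x)T_q(y).$$ (4) In all other cases the fiber is empty, i.e. $(x,y)$ is not in the image.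
   Context: $SU(2)$ is identified with the unit quaternions; $C(\mathbf i)$ is the set of pure unit quaternions; $e^{tQ}=\cos t+\sin t\,Q$ for $Q\in C(\mathbf i)$. Two pairs $(M,N),(M',N')$ of unit quaternions are conjugate if $(M',N')=(gMg^{-1},gNg^{-1})$ for some $g\in SU(2)$. $$V_{p,q,r,s}=\{(M,N)\in SU(2)\times SU(2)\mid M^{s+p}N^{q-r}=\mathbf i,\ N^{-r}M^s=e^{\gamma\mathbf k}\mathbf i\text{ for some }\gamma\in[0,\pi]\}.$$ (It parameterizes the traceless $SU(2)$ representations, up to conjugation, of the complement of a certain 2-stranded tangle in the $(p,q)$ torus knot.) For each integer $n$, $T_n$ and $S_n$ are the (Chebyshev) polynomials with $\cos(nu)=T_n(\cos u)$ and $\sin(nu)=\sin u\,S_n(\cos u)$. Define $$p_{p,q,r,s}(x,y)=T_{s+p}(x)T_{q-r}(y)S_s(x)S_{-r}(y)-S_{s+p}(x)S_{q-r}(y)T_s(x)T_{-r}(y),$$ with zero set $Z$. Consider the two ratios $$\frac{T_{s+p}(x)T_{q-r}(y)}{\sqrt{(1-x^2)(1-y^2)}\,S_{s+p}(x)S_{q-r}(y)},\qquad\frac{T_s(x)T_{-r}(y)}{\sqrt{(1-x^2)(1-y^2)}\,S_s(x)S_{-r}(y)},$$ which agree at points of $Z$ where neither denominator vanishes. $Z_0\subset Z$ is the subset of points where at least one of the two denominators is nonzero and, if the other denominator is zero, so is its numerator; on $Z_0$, $\tau(x,y)$ is the value of either ratio whose denominator is nonzero. $Z_1\subset Z$ is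 the subset of points where both denominators and both numerators are zero. (Only points with $|x|\le1$, $|y|\le1$ are relevant.) Pillowcase. $R(S^2,\{a,b,c,d\})$ is the space of conjugacy classes of homomorphisms $\langle a,b,c,d\mid ba=cd\rangle\to SU(2)$ sending each generator into $C(\mathbf i)$, identified with $\mathbb{R}^2/\sim$, $(\gamma,\theta)\sim(-\gamma,-\theta)\sim(\gamma+2\pi m,\theta+2\pi n)$, by $(\gamma,\theta)\leftrightarrow[a\mapsto\mathbf i,b\mapsto e^{\gamma\mathbf k}\mathbf i,c\mapsto e^{\theta\mathbf k}\mathbf i,d\mapsto e^{(\theta-\gamma)\mathbf k}\mathbf i]$. The point of the pillowcase corresponding to $(M,N)\in V_{p,q,r,s}$ is the class of $a\mapsto M^{s+p}N^{q-r}$, $b\mapsto N^{-r}M^s$, $c\mapsto N^{-r}M^{s+p}N^q$, $d\mapsto N^{-q}M^sN^{q-r}$.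
   Formalization: In (1), ''a single point'' is read as: nonempty, all elements conjugate, and literally one point unless N^{-r}M^s=±i and MN≠NM; in that case the literal fiber is a circle, e.g. (p,q,r,s)=(3,4,-1,1), (x,y)=(cos(2π/5),0). *)

(* Defs.v *)
From HB Require Import structures.
From mathcomp Require Import all_boot all_order all_algebra.
From mathcomp Require Import all_classical all_reals all_analysis.
From mathcomp Require Import ring lra.
Import Order.TTheory GRing.Theory Num.Theory.
Import numFieldNormedType.Exports.

Set Implicit Arguments.
Unset Strict Implicit.
Unset Printing Implicit Defensive.

Local Open Scope classical_set_scope.
Local Open Scope ring_scope.

(* quat R is made a unitRingType and an R-algebra, so that [M ^ n] is ssrint's
   power for an integer exponent [n] and [a%:A] is the real quaternion [a]. *)
Record quat (R : Type) := Quat { qre : R; qim1 : R; qim2 : R; qim3 : R }.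

Section QuaternionRing.
Variable R : realFieldType.
Implicit Types x y z : quat R.

Definition quat_tuple x := (qre x, qim1 x, qim2 x, qim3 x).
Definition tuple_quat (t : R * R * R * R) :=
  Quat t.1.1.1 t.1.1.2 t.1.2 t.2.

Lemma quat_tupleK : cancel quat_tuple tuple_quat.
Proof. by case. Qed.

HB.instance Definition _ := Choice.copy (quat R) (can_type quat_tupleK).

Definition addq x y := Quat (qre x + qre y) (qim1 x + qim1 y)
  (qim2 x + qim2 y) (qim3 x + qim3 y).
Definition oppq x := Quat (- qre x) (- qim1 x) (- qim2 x) (- qim3 x).
Definition mulq x y := Quat
  (qre x * qre y - qim1 x * qim1 y - qim2 x * qim2 y - qim3 x * qim3 y)
  (qre x * qim1 y + qim1 x * qre y + qim2 x * qim3 y - qim3 x * qim2 y)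
  (qre x * qim2 y - qim1 x * qim3 y + qim2 x * qre y + qim3 x * qim1 y)
  (qre x * qim3 y + qim1 x * qim2 y - qim2 x * qim1 y + qim3 x * qre y).
Definition scaleq (a : R) x :=
  Quat (a * qre x) (a * qim1 x) (a * qim2 x) (a * qim3 x).

Definition qnorm2 x := qre x ^+ 2 + qim1 x ^+ 2 + qim2 x ^+ 2 + qim3 x ^+ 2.
Definition conjq x := Quat (qre x) (- qim1 x) (- qim2 x) (- qim3 x).

Let quat0 : quat R := Quat 0 0 0 0.
Let quat1 : quat R := Quat 1 0 0 0.

Lemma addqA : associative addq.
Proof. by case=> ????[????][????]; rewrite /addq /= !addrA. Qed.
Lemma addqC : commutative addq.
Proof. by case=> a b c d[a' b' c' d']; congr Quat; exact: addrC. Qed.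
Lemma add0q : left_id quat0 addq.
Proof. by case=> ????; rewrite /addq /= !add0r. Qed.
Lemma addNq : left_inverse quat0 oppq addq.
Proof. by case=> ????; rewrite /addq /= !addNr. Qed.

HB.instance Definition _ :=
  GRing.isZmodule.Build (quat R) addqA addqC add0q addNq.

Lemma mulqA : associative mulq.
Proof. by case=> ????[????][????]; congr Quat => /=; ring. Qed.
Lemma mul1q : left_id quat1 mulq.
Proof. by case=> ????; congr Quat => /=; ring. Qed.
Lemma mulq1 : right_id quat1 mulq.
Proof. by case=> ????; congr Quat => /=; ring. Qed.
Lemma mulqDl : left_distributive mulq +%R.
Proof. by case=> ????[????][????]; congr Quat => /=; ring. Qed.
Lemma mulqDr : right_distributive mulq +%R.
Proof. by case=> ????[????][????]; congr Quat => /=; ring. Qed.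
Lemma quat1_neq0 : quat1 != 0.
Proof. by apply/eqP => -[] /eqP; rewrite oner_eq0. Qed.

HB.instance Definition _ := GRing.Zmodule_isNzRing.Build (quat R)
  mulqA mul1q mulq1 mulqDl mulqDr quat1_neq0.

Lemma scaleqA a b x : scaleq a (scaleq b x) = scaleq (a * b) x.
Proof. by case: x => ????; congr Quat => /=; ring. Qed.
Lemma scale1q : left_id 1 scaleq.
Proof. by case=> ????; rewrite /scaleq /= !mul1r. Qed.
Lemma scaleqDr : right_distributive scaleq +%R.
Proof. by move=> ?[????][????]; congr Quat => /=; ring. Qed.
Lemma scaleqDl x : {morph scaleq^~ x : a b / a + b}.
Proof. by case: x => ???? ??; congr Quat => /=; ring. Qed.

HB.instance Definition _ := GRing.Zmodule_isLmodule.Build R (quat R)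
  scaleqA scale1q scaleqDr scaleqDl.

Lemma scaleqAl (a : R) x y : a *: (x * y) = (a *: x) * y.
Proof. by case: x y => ????[????]; congr Quat => /=; ring. Qed.

HB.instance Definition _ := GRing.Lmodule_isLalgebra.Build R (quat R) scaleqAl.

Definition invq x : quat R := (qnorm2 x)^-1 *: conjq x.

Lemma qnorm2_eq0 x : (qnorm2 x == 0) = (x == 0).
Proof.
apply/eqP/eqP => [|->]; last by rewrite /qnorm2 /= !expr0n /= !addr0.
case: x => a b c d; rewrite /qnorm2 /= => h.
have h2 (u : R) : u ^+ 2 <= 0 -> u = 0.
  by rewrite le_eqVlt sqrf_eq0 ltNge sqr_ge0 orbF => /eqP.
have := (sqr_ge0 a, sqr_ge0 b, sqr_ge0 c, sqr_ge0 d) => -[[[]]] *.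
by congr Quat; apply: h2; lra.
Qed.

Lemma mulVq : {in [pred x | x != 0], left_inverse 1 invq *%R}.
Proof.
move=> x; rewrite inE -qnorm2_eq0 => h.
rewrite /invq -scaleqAl; apply: (@eq_trans _ _ ((qnorm2 x)^-1 *: (qnorm2 x)%:A)).
  by congr (_ *: _); case: x {h} => ????; congr Quat; rewrite /qnorm2 /=; ring.
by rewrite scalerA mulVf// scale1r.
Qed.

Lemma mulqV : {in [pred x | x != 0], right_inverse 1 invq *%R}.
Proof.
move=> x; rewrite inE -qnorm2_eq0 => h.
apply: (@eq_trans _ _ ((qnorm2 x)^-1 *: (qnorm2 x)%:A)); last first.
  by rewrite scalerA mulVf// scale1r.
by case: x {h} => a b c d; congr Quat; rewrite /qnorm2 /=; ring.
Qed.

Lemma unitqP x y : y * x = 1 /\ x * y = 1 -> [pred x | x != 0] x.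
Proof.
move=> [yx _] /=; apply/eqP => x0; move/eqP: yx.
by rewrite x0 mulr0 eq_sym oner_eq0.
Qed.

Lemma invq_out : {in [predC [pred x | x != 0]], invq =1 id}.
Proof.
move=> x; rewrite !inE negbK => /eqP ->.
have c0 : conjq 0 = 0 by congr Quat; rewrite oppr0.
by rewrite /invq c0 scaler0.
Qed.

HB.instance Definition _ := GRing.NzRing_hasMulInverse.Build (quat R)
  mulVq mulqV unitqP invq_out.

Definition qi : quat R := Quat 0 1 0 0.
Definition qk : quat R := Quat 0 0 0 1.

Definition SU2 : set (quat R) := [set M | qnorm2 M = 1].

(* C(i) *)
Definition pure_unit : set (quat R) := [set Q | SU2 Q /\ qre Q = 0].

Definition conj_pair (w w' : quat R * quat R) : Prop :=
  exists g, SU2 g /\ w' = (g * w.1 * g^-1, g * w.2 * g^-1).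

End QuaternionRing.

Arguments qi {R}.
Arguments qk {R}.
Arguments SU2 {R}.
Arguments pure_unit {R}.

Section Chebyshev.
Variable R : realType.

(* The addition formulas for cos ((n + 1) u) and sin ((n + 1) u). *)
Fixpoint chebTS (n : nat) : {poly R} * {poly R} :=
  if n is m.+1 then
    let: (t, s) := chebTS m in
    ('X * t - (1 - 'X ^+ 2) * s, 'X * s + t)
  else (1, 0).

Definition chebT (n : int) : {poly R} := (chebTS `|n|%N).1.
Definition chebS (n : int) : {poly R} :=
  match n with Posz m => (chebTS m).2 | Negz m => - (chebTS m.+1).2 end.

Lemma chebTSE (n : nat) (u : R) :
  cos (n%:R * u) = (chebTS n).1.[cos u] /\
  sin (n%:R * u) = sin u * (chebTS n).2.[cos u].
Proof.
elim: n => [|n [IHc IHs]] /=; first by rewrite mul0r cos0 sin0 !hornerE ?mulr0.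
rewrite -natr1 mulrDl mul1r cosD sinD IHc IHs.
case: (chebTS n) => t s /=; rewrite !hornerE -sin2cos2.
by split; ring.
Qed.

Lemma chebTE (n : int) (u : R) : cos (n%:~R * u) = (chebT n).[cos u].
Proof.
case: n => n; first by have [] := chebTSE n u.
by rewrite NegzE mulrNz mulNr cosN; have [] := chebTSE n.+1 u.
Qed.

Lemma chebSE (n : int) (u : R) : sin (n%:~R * u) = sin u * (chebS n).[cos u].
Proof.
case: n => n; first by have [] := chebTSE n u.
by rewrite NegzE mulrNz mulNr sinN hornerN mulrN; have [_ ->] := chebTSE n.+1 u.
Qed.

End Chebyshev.

Arguments chebT {R}.
Arguments chebS {R}.

Section TorusKnotTangle.
Variable R : realType.
Implicit Types (p q r s : int) (x y t u v gam the : R).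

(* e^{tQ} *)
Definition expq (t : R) (Q : quat R) : quat R := (cos t)%:A + sin t *: Q.

Definition V p q r s : set (quat R * quat R) := [set w |
  [/\ SU2 w.1, SU2 w.2, w.1 ^ (s + p) * w.2 ^ (q - r) = qi &
      exists2 gam : R, 0 <= gam <= pi & w.2 ^ (- r) * w.1 ^ s = expq gam qk * qi]].

(* The fiber over (x, y) of (e^{uQ}, e^{vR}) |-> (cos u, cos v); every element
   of SU(2) has the form e^{uQ}, and u is determined by it (see [SU2_expq] and
   [qre_expq]), so this map is well defined on all of V. *)
Definition fiber p q r s x y : set (quat R * quat R) := [set w |
  V p q r s w /\
  exists u v Q Q', [/\ 0 <= u <= pi, 0 <= v <= pi, pure_unit Q, pure_unit Q' &
    w = (expq u Q, expq v Q') /\ (cos u, cos v) = (x, y)]].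

Lemma qre_expq u Q : pure_unit Q -> qre (expq u Q) = cos u.
Proof. by move=> [_ h]; rewrite /= h mulr0 addr0 mulr1. Qed.

Lemma SU2_expq (M : quat R) : SU2 M ->
  exists2 u, 0 <= u <= pi & exists2 Q, pure_unit Q & M = expq u Q.
Proof.
case: M => a b c d; rewrite /SU2 /qnorm2 /= => h.
have := (sqr_ge0 b, sqr_ge0 c, sqr_ge0 d) => -[[hb hc] hd].
have ha : -1 <= a <= 1 by apply/andP; split; nra.
exists (acos a); first by rewrite acos_ge0// acos_lepi.
have cosa : cos (acos a) = a by rewrite acosK// in_itv.
have sina : sin (acos a) ^+ 2 = 1 - a ^+ 2 by rewrite sin2cos2 cosa.
have [s0|s0] := eqVneq (sin (acos a)) 0.
  exists qi; first by split=> //; rewrite /SU2 /qnorm2 /=; ring.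
  have b0 : b ^+ 2 = 0 by move: sina; rewrite s0; lra.
  have c0 : c ^+ 2 = 0 by move: sina; rewrite s0; lra.
  have d0 : d ^+ 2 = 0 by move: sina; rewrite s0; lra.
  move/eqP: b0; move/eqP: c0; move/eqP: d0; rewrite !sqrf_eq0.
  by move=> /eqP-> /eqP-> /eqP->; congr Quat; rewrite /= cosa s0; ring.
set S := sin (acos a) in s0 sina *.
exists (Quat 0 (b / S) (c / S) (d / S)).
  split=> //; rewrite /SU2 /qnorm2 /= !expr_div_n sina.
  have : 1 - a ^+ 2 != 0 by rewrite -sina sqrf_eq0.
  by move=> ?; rewrite expr0n /= add0r -!mulrDl -[X in X / _](_ : 1 - a ^+ 2 = _) ?divff//; lra.
by congr Quat; rewrite /= cosa -/S; field.
Qed.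

Definition pfun p q r s x y : R :=
  (chebT (s + p)).[x] * (chebT (q - r)).[y] * (chebS s).[x] * (chebS (- r)).[y]
  - (chebS (s + p)).[x] * (chebS (q - r)).[y] * (chebT s).[x] * (chebT (- r)).[y].

Definition Z p q r s : set (R * R) := [set z | pfun p q r s z.1 z.2 = 0].

Definition num1 p q r s x y : R := (chebT (s + p)).[x] * (chebT (q - r)).[y].
Definition den1 p q r s x y : R := Num.sqrt ((1 - x ^+ 2) * (1 - y ^+ 2)) *
  (chebS (s + p)).[x] * (chebS (q - r)).[y].
Definition num2 (r s : int) x y : R := (chebT s).[x] * (chebT (- r)).[y].
Definition den2 (r s : int) x y : R := Num.sqrt ((1 - x ^+ 2) * (1 - y ^+ 2)) *
  (chebS s).[x] * (chebS (- r)).[y].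

Definition Z0 p q r s : set (R * R) := [set z | [/\ Z p q r s z,
  den1 p q r s z.1 z.2 != 0 \/ den2 r s z.1 z.2 != 0,
  den1 p q r s z.1 z.2 = 0 -> num1 p q r s z.1 z.2 = 0 &
  den2 r s z.1 z.2 = 0 -> num2 r s z.1 z.2 = 0]].

Definition Z1 p q r s : set (R * R) := [set z | [/\ Z p q r s z,
  den1 p q r s z.1 z.2 = 0 /\ num1 p q r s z.1 z.2 = 0 &
  den2 r s z.1 z.2 = 0 /\ num2 r s z.1 z.2 = 0]].

(* Only meaningful on Z0, where the second ratio can be used as well whenever
   its denominator is nonzero (see [tau_ratio2]). *)
Definition tau p q r s x y : R :=
  if den1 p q r s x y != 0 then num1 p q r s x y / den1 p q r s x y
  else num2 r s x y / den2 r s x y.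

Lemma tau_ratio2 p q r s x y : Z p q r s (x, y) -> den2 r s x y != 0 ->
  tau p q r s x y = num2 r s x y / den2 r s x y.
Proof.
rewrite /tau; case: ifP => // d1 h d2.
apply/eqP; rewrite eqr_div// -subr_eq0; apply/eqP.
rewrite /num1 /num2 /den1 /den2; set w := Num.sqrt _.
apply: (@eq_trans _ _ (w * pfun p q r s x y)); first by rewrite /pfun; ring.
by rewrite [pfun _ _ _ _ _ _]h mulr0.
Qed.

(* Homomorphisms <a,b,c,d | ba = cd> -> SU(2) sending each generator to C(i),
   given by the images of a, b, c, d. *)
Record S2rep := { rep_a : quat R; rep_b : quat R; rep_c : quat R; rep_d : quat R;
  rep_pure : [/\ pure_unit rep_a, pure_unit rep_b, pure_unit rep_c & pure_unit rep_d];
  rep_rel : rep_b * rep_a = rep_c * rep_d }.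

(* The class of [f] in R(S^2,{a,b,c,d}) is the point of the pillowcase
   represented by (gam, the). *)
Definition pillow_point (f : S2rep) gam the : Prop :=
  exists g, [/\ SU2 g,
    g * rep_a f * g^-1 = qi,
    g * rep_b f * g^-1 = expq gam qk * qi,
    g * rep_c f * g^-1 = expq the qk * qi &
    g * rep_d f * g^-1 = expq (the - gam) qk * qi].

Definition rep_of_pair p q r s (w : quat R * quat R) (f : S2rep) : Prop :=
  [/\ rep_a f = w.1 ^ (s + p) * w.2 ^ (q - r),
      rep_b f = w.2 ^ (- r) * w.1 ^ s,
      rep_c f = w.2 ^ (- r) * w.1 ^ (s + p) * w.2 ^ q &
      rep_d f = w.2 ^ (- q) * w.1 ^ s * w.2 ^ (q - r)].

Definition image_point p q r s w gam the : Prop :=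
  exists2 f, rep_of_pair p q r s w f & pillow_point f gam the.

(* The image of [w] in the pillowcase is defined, and P holds at every
   (gam, the) in R^2 representing it. *)
Definition image_satisfies p q r s w (P : R -> R -> Prop) : Prop :=
  (exists gam the, image_point p q r s w gam the) /\
  (forall gam the, image_point p q r s w gam the -> P gam the).

Definition generic_case p q r s x y : Prop :=
  [/\ `|x| < 1, `|y| < 1, Z0 p q r s (x, y) & `|tau p q r s x y| <= 1].

Definition arc_case p q r s x y : Prop :=
  [/\ `|x| < 1, `|y| < 1 & Z1 p q r s (x, y)].

Definition boundary_case p q r s x y : Prop :=
  [/\ `|x| <= 1, `|y| <= 1, `|x| = 1 \/ `|y| = 1 & Z1 p q r s (x, y)].

(* The pair (e^{uQ}, e^{vR}) with Q = i and R = e^{tk} i *)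
Definition model_pair u v t : quat R * quat R :=
  (expq u qi, expq v (expq t qk * qi)).

(* V consists of representatives of conjugacy classes, but when
   N^{-r} M^s = i or -i (that is, gam = 0 or pi) conjugation by e^{ai}, a in R,
   preserves V, and it moves (M, N) as soon as MN <> NM. So F is a single
   point up to conjugation, and a single point of SU(2) x SU(2) except in that
   situation. *)
Definition single_point_upto_conj r s (F : set (quat R * quat R)) : Prop :=
  [/\ F !=set0,
      forall w w', F w -> F w' -> conj_pair w w' &
      forall w w', F w -> F w' ->
        ((w.2 ^ (- r) * w.1 ^ s = qi \/ w.2 ^ (- r) * w.1 ^ s = - qi) ->
         w.1 * w.2 = w.2 * w.1) ->
        w = w'].

(* Continuity on A for the topology of R^4 x R^4. *)
Definition path_continuous (A : set R) (c : R -> quat R * quat R) : Prop :=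
  {within A, continuous (fun t => (quat_tuple (c t).1, quat_tuple (c t).2))}.

(* F is the arc c(t), 0 <= t <= pi: a continuous injective image of the compact
   interval, so homeomorphic to it. *)
Definition is_arc (F : set (quat R * quat R)) (c : R -> quat R * quat R) : Prop :=
  [/\ path_continuous `[0, pi] c, {in `[0, pi] &, injective c} &
      c @` `[0, pi] = F].

End TorusKnotTangle.

(* Main.v *)
(* For [M = e^{uA}] and [N = e^{vB}] the real part of [M^a N^b] is
   [T_a(x) T_b(y) - sin u sin v S_a(x) S_b(y) (A . B)], affine in the cosine
   [A . B] of the angle between the axes.  A pair can be conjugated into [V]
   exactly when [M^(s+p) N^(q-r)] and [N^(-r) M^s] are both traceless, that is,
   when [A . B] solves two affine equations; eliminating it gives the polynomial,
   and their solution is [tau], everything in [[-1, 1]], or nothing.  Two pairs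
   with the same [x], [y] and [A . B] (irrelevant if [sin u sin v = 0]) are
   conjugate, and [V] meets a conjugacy class at most once unless
   [N^(-r) M^s = +-i] with [M] and [N] not commuting.  When both equations are
   void, the two words are, up to sign, the two axes [A] and [B], which makes the
   fiber an explicit arc.  The angles in the pillowcase are read off from the
   traces of [b a] and [b c^-1]. *)

Require Import Defs.
From HB Require Import structures.
From mathcomp Require Import all_boot all_order all_algebra.
From mathcomp Require Import all_classical all_reals all_analysis.
From mathcomp Require Import ring lra.
Import Order.TTheory GRing.Theory Num.Theory.
Import numFieldNormedType.Exports.

Set Implicit Arguments.
Unset Strict Implicit.
Unset Printing Implicit Defensive.

Local Open Scope classical_set_scope.
Local Open Scope ring_scope.

(** * Unit quaternions: conjugation, polar form and normal forms of axes *)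

Section Quaternions.
Variable R : realType.
Implicit Types (x y z g A B M N Q : quat R) (t u v : R) (n : int).

Definition dotq A B : R := qim1 A * qim1 B + qim2 A * qim2 B + qim3 A * qim3 B.

Lemma qnorm2M x y : qnorm2 (x * y) = qnorm2 x * qnorm2 y.
Proof. by case: x y => a b c d [a' b' c' d']; rewrite /qnorm2 /=; ring. Qed.

Lemma qre_mulC x y : qre (x * y) = qre (y * x).
Proof. by case: x y => a b c d [a' b' c' d'] /=; ring. Qed.

Lemma scaleqAr (a : R) x y : a *: (x * y) = x * (a *: y).
Proof. by case: x y => ????[????]; congr Quat => /=; ring. Qed.

Lemma SU2_unit x : SU2 x -> x \is a GRing.unit.
Proof.
move=> h; rewrite unfold_in /= -qnorm2_eq0; rewrite /SU2 /= in h.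
by rewrite h oner_eq0.
Qed.

Lemma SU2_inv x : SU2 x -> x^-1 = conjq x.
Proof.
rewrite /SU2 /= => h.
by rewrite -[LHS]/(Defs.invq x) /Defs.invq h invr1 scale1r.
Qed.

Lemma SU2_conjq x : SU2 x -> SU2 (conjq x).
Proof. by rewrite /SU2 /= /qnorm2 /= !sqrrN. Qed.

Lemma SU2V x : SU2 x -> SU2 x^-1.
Proof. by move=> h; rewrite SU2_inv//; exact: SU2_conjq. Qed.

Lemma SU2M x y : SU2 x -> SU2 y -> SU2 (x * y).
Proof. by rewrite /SU2 /= qnorm2M => -> ->; rewrite mulr1. Qed.

Lemma conjrM g x y : SU2 g ->
  g * (x * y) * g^-1 = (g * x * g^-1) * (g * y * g^-1).
Proof. by move=> /SU2_unit ug; rewrite !mulrA divrK// ?mulrVK// mulrA. Qed.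

Lemma conjr_inj g x y : SU2 g -> g * x * g^-1 = g * y * g^-1 -> x = y.
Proof.
by move=> /SU2_unit ug /(mulIr (etrans (unitrV g) ug)) /(mulrI ug).
Qed.

Lemma conjr_comp g g' x : SU2 g -> SU2 g' ->
  (g' * g) * x * (g' * g)^-1 = g' * (g * x * g^-1) * g'^-1.
Proof. by move=> /SU2_unit ? /SU2_unit ?; rewrite invrM// !mulrA. Qed.

Lemma SU2_conjr g x : SU2 g -> SU2 x -> SU2 (g * x * g^-1).
Proof. by move=> hg hx; apply: SU2M (SU2V hg); exact: SU2M. Qed.

Lemma qre_conjr g x : SU2 g -> qre (g * x * g^-1) = qre x.
Proof. by move=> hg; rewrite qre_mulC mulrA mulVr ?mul1r// SU2_unit. Qed.

Lemma pure_unit_conjr g Q : SU2 g -> pure_unit Q -> pure_unit (g * Q * g^-1).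
Proof. by move=> hg [hQ Q0]; split; [exact: SU2_conjr | rewrite qre_conjr]. Qed.

Lemma pure_unit_qi : pure_unit (qi : quat R).
Proof. by split=> //; rewrite /SU2 /qnorm2 /=; ring. Qed.

Lemma pure_unit_sqr Q : pure_unit Q -> Q * Q = -1.
Proof.
case: Q => a b c d [+ /= a0]; rewrite a0 /SU2 /qnorm2 /= => h.
by congr Quat => /=; first (by move: h; lra); ring.
Qed.

Lemma qre_mul_pure A B : pure_unit A -> pure_unit B -> qre (A * B) = - dotq A B.
Proof.
by case: A B => ????[????] [_ /= ->] [_ /= ->]; rewrite /dotq /=; ring.
Qed.

(** For pure unit quaternions the dot product is minus the real part of the product, and real parts
    are invariant under conjugation. *)
Lemma dotq_conjr g A B : SU2 g -> pure_unit A -> pure_unit B ->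
  dotq (g * A * g^-1) (g * B * g^-1) = dotq A B.
Proof.
move=> hg hA hB; apply: oppr_inj.
have hA' := pure_unit_conjr hg hA; have hB' := pure_unit_conjr hg hB.
by rewrite -(qre_mul_pure hA' hB') -(qre_mul_pure hA hB) -conjrM// qre_conjr.
Qed.

(** Expand [|A - B|^2 >= 0] and [|A + B|^2 >= 0]. *)
Lemma dotq_bound A B : pure_unit A -> pure_unit B -> -1 <= dotq A B <= 1.
Proof.
case: A B => a b c d [a' b' c' d'] [+ /= a0] [+ /= a0'].
rewrite a0 a0' /SU2 /qnorm2 /dotq /= => h h'.
have := (sqr_ge0 (b - b'), sqr_ge0 (c - c'), sqr_ge0 (d - d')) => -[[]].
have := (sqr_ge0 (b + b'), sqr_ge0 (c + c'), sqr_ge0 (d + d')) => -[[]].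
by move=> *; apply/andP; split; lra.
Qed.

Lemma expqE t Q : pure_unit Q ->
  expq t Q = Quat (cos t) (sin t * qim1 Q) (sin t * qim2 Q) (sin t * qim3 Q).
Proof. by case: Q => ???? [_ /= ->]; congr Quat => /=; ring. Qed.

Lemma expqD t u Q : pure_unit Q -> expq (t + u) Q = expq t Q * expq u Q.
Proof.
move=> hQ; rewrite /expq mulrDl !mulrDr -!scalerAl -!scaleqAr !mul1r mulr1.
rewrite pure_unit_sqr// cosD sinD.
by case: Q {hQ} => ????; congr Quat => /=; ring.
Qed.

Lemma expq0 Q : expq 0 Q = 1.
Proof. by rewrite /expq cos0 sin0 scale0r scale1r addr0. Qed.

Lemma SU2_expq_pure t Q : pure_unit Q -> SU2 (expq t Q).
Proof.
move=> hQ; have [+ _] := hQ; rewrite expqE// /SU2 /qnorm2 /= => h.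
have q0 := hQ.2; rewrite q0 in h.
rewrite -(cos2Dsin2 t) -[X in _ = _ + X]mulr1 -[X in _ = _ + _ * X]h; ring.
Qed.

Lemma expqN t Q : pure_unit Q -> expq (- t) Q = (expq t Q)^-1.
Proof.
move=> hQ; apply: (mulrI (SU2_unit (SU2_expq_pure t hQ))).
by rewrite -expqD// subrr expq0 divrr// SU2_unit//; exact: SU2_expq_pure.
Qed.

Lemma expq_exprz t Q n : pure_unit Q -> expq t Q ^ n = expq (n%:~R * t) Q.
Proof.
move=> hQ; have pn (m : nat) : expq t Q ^+ m = expq (m%:R * t) Q.
  elim: m => [|m IH]; first by rewrite expr0 mul0r expq0.
  by rewrite exprSr IH -expqD// -natr1 mulrDl mul1r.
case: n => n; first by rewrite -exprnP pn.
by rewrite NegzE -exprnN pn mulrNz mulNr expqN.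
Qed.

Lemma expq_conjr g t Q : SU2 g -> g * expq t Q * g^-1 = expq t (g * Q * g^-1).
Proof.
move=> /SU2_unit /divrr; move: g^-1 => h gh.
by rewrite /expq mulrDr mulrDl -!scaleqAr -!scalerAl mulr1 gh.
Qed.

(** In polar form a power only multiplies the angle and a conjugation only moves the axis, so all
    integer exponents are treated at once. *)
Lemma exprz_conjr g M n : SU2 g -> SU2 M ->
  (g * M * g^-1) ^ n = g * M ^ n * g^-1.
Proof.
move=> hg /SU2_expq[u _ [Q hQ ->]].
by rewrite expq_conjr// !expq_exprz ?expq_conjr//; exact: pure_unit_conjr.
Qed.

Lemma SU2_exprz M n : SU2 M -> SU2 (M ^ n).
Proof.
by move=> /SU2_expq[u _ [Q hQ ->]]; rewrite expq_exprz//; exact: SU2_expq_pure.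
Qed.

Lemma expq_qk_qi t : expq t qk * qi = Quat 0 (cos t) (sin t) 0.
Proof. by congr Quat => /=; ring. Qed.

Lemma pure_unit_expq_qi t : pure_unit (expq t qk * qi).
Proof.
rewrite expq_qk_qi; split=> //; rewrite /SU2 /qnorm2 /=.
by have := cos2Dsin2 t; lra.
Qed.

(* Only [g * x = x' * g] matters, since [g] can be normalised. *)
Lemma SU2_conj_of_intertwine x y x' y' g : g != 0 ->
  g * x = x' * g -> g * y = y' * g ->
  exists h, [/\ SU2 h, h * x * h^-1 = x' & h * y * h^-1 = y'].
Proof.
rewrite -qnorm2_eq0 => g0 gx gy.
have gp : 0 < qnorm2 g.
  by rewrite lt_neqAle eq_sym g0 /qnorm2 !addr_ge0// sqr_ge0.
set k := (Num.sqrt (qnorm2 g))^-1.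
have hS : SU2 (k *: g).
  rewrite /SU2 /=; transitivity (k ^+ 2 * qnorm2 g).
    by rewrite /qnorm2 /=; ring.
  by rewrite exprVn sqr_sqrtr ?ltW// mulVf.
exists (k *: g); split=> //.
  by rewrite -scalerAl gx scaleqAr mulrK// SU2_unit.
by rewrite -scalerAl gy scaleqAr mulrK// SU2_unit.
Qed.

Lemma pure_unit_conj_qi A : pure_unit A -> exists2 g, SU2 g & g * A * g^-1 = qi.
Proof.
case: A => a b c d [+ /= a0]; rewrite a0 /SU2 /qnorm2 /= => h.
(* The intertwiner [1 - i A] vanishes exactly at [A = -i]; there [j] conjugates [-i] to [i]. *)
have [b1|b1] := eqVneq b (-1).
  have [|||g [hg gA _]]
    := @SU2_conj_of_intertwine (Quat 0 b c d) 0 qi 0 (Quat 0 0 1 0).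
  - by apply/eqP => -[/eqP]; rewrite oner_eq0.
  - rewrite b1 in h.
    have c0 : c = 0 by apply/eqP; rewrite -sqrf_eq0; apply/eqP; nra.
    have d0 : d = 0 by apply/eqP; rewrite -sqrf_eq0; apply/eqP; nra.
    by rewrite b1 c0 d0; congr Quat => /=; ring.
  - by rewrite mulr0 mul0r.
  by exists g.
(* [1 - i A] intertwines [A] and [i] *)
have [|||g [hg gA _]]
  := @SU2_conj_of_intertwine (Quat 0 b c d) 0 qi 0 (1 - qi * Quat 0 b c d).
- by apply: contra b1 => /eqP -[/= e _ _ _]; apply/eqP; lra.
- by congr Quat => /=; first ring; [move: h => h; nra|ring|ring].
- by rewrite mulr0 mul0r.
by exists g.
Qed.

(** Once [A] is moved to [i], a rotation about the i-axis brings [B] into the half-plane of the (i,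
    j)-plane with non-negative j-component, where its angle from [i] is the [acos] of the dot
    product. *)
Lemma pure_unit_frame A B : pure_unit A -> pure_unit B -> exists g,
  [/\ SU2 g, g * A * g^-1 = qi & g * B * g^-1 = expq (acos (dotq A B)) qk * qi].
Proof.
move=> hA hB; have [g hg gA] := pure_unit_conj_qi hA.
have dB := dotq_bound hA hB.
rewrite -(dotq_conjr hg hA hB) gA in dB *.
have := pure_unit_conjr hg hB; move: dB; case gB: (g * B * g^-1) => [a b c d].
rewrite /dotq /= !mul0r !addr0 mul1r => dB [+ /= a0].
rewrite a0 /SU2 /qnorm2 /= => h.
have hr : 0 <= 1 - b ^+ 2 by have := (sqr_ge0 c, sqr_ge0 d) => -[]; lra.
rewrite expq_qk_qi sin_acos// acosK; last by rewrite in_itv.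
set rho := Num.sqrt _; have rho0 : 0 <= rho by rewrite sqrtr_ge0.
have rho2 : rho ^+ 2 = c ^+ 2 + d ^+ 2 by rewrite sqr_sqrtr//; lra.
have [g' [hg' g'i g'B]] : exists g',
    [/\ SU2 g', g' * qi * g'^-1 = qi :> quat R &
    g' * Quat 0 b c d * g'^-1 = Quat 0 b rho 0].
  (* The rotation of [(c, d)] to [(rho, 0)] is conjugation by a multiple of [rho + c - d i], by the
     half-angle formula. This quaternion is zero when [rho + c = 0], where [d = 0] as well and the
     half-turn [i] does the job. *)
  have [e|e] := eqVneq (rho + c) 0.
    have d0 : d = 0.
      apply/eqP; rewrite -sqrf_eq0; apply/eqP.
      by have -> : d ^+ 2 = (rho + c) * (rho - c); [ring: rho2|rewrite e mul0r].
    apply: (@SU2_conj_of_intertwine _ _ _ _ qi).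
    - by apply/eqP => -[/eqP]; rewrite oner_eq0.
    - by [].
    - have -> : c = - rho by lra.
      by rewrite d0; congr Quat => /=; ring.
  apply: (@SU2_conj_of_intertwine _ _ _ _ (Quat (rho + c) (- d) 0 0)).
  - by apply: contra e => /eqP -[/= -> _].
  - by congr Quat => /=; ring.
  - by congr Quat => /=; [ring|ring|ring: rho2|ring: rho2].
exists (g' * g); split; first exact: SU2M.
  by rewrite conjr_comp// gA.
by rewrite conjr_comp// gB a0.
Qed.

End Quaternions.

(** * Conjugacy of pairs and traces of words in them *)

Section Pairs.
Variable R : realType.
Implicit Types (Q A B M N g : quat R) (u v t x y : R) (w : quat R * quat R).

Lemma dotq_expq_qi t : dotq qi (expq t qk * qi) = cos t :> R.
Proof. by rewrite expq_qk_qi /dotq /=; ring. Qed.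

Lemma dotqq Q : pure_unit Q -> dotq Q Q = 1.
Proof.
case: Q => a b c d [+ /= a0]; rewrite a0 /SU2 /qnorm2 /dotq /=; lra.
Qed.

(** Both pairs have the same normal form in [pure_unit_frame]; one conjugator is composed with the
    inverse of the other. *)
Lemma pure_unit_pair_conj A B A' B' : pure_unit A -> pure_unit B ->
  pure_unit A' -> pure_unit B' -> dotq A B = dotq A' B' ->
  exists g, [/\ SU2 g, A' = g * A * g^-1 & B' = g * B * g^-1].
Proof.
move=> hA hB hA' hB' e.
have [g [hg gA gB]] := pure_unit_frame hA hB.
have [h [hh hA1 hB1]] := pure_unit_frame hA' hB'.
have hV := SU2V hh; exists (h^-1 * g); split; first exact: SU2M.
- apply: (conjr_inj hh); rewrite conjr_comp// gA hA1 invrK.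
  by rewrite !mulrA divrr ?SU2_unit// mul1r mulrK// SU2_unit.
- apply: (conjr_inj hh); rewrite conjr_comp// gB hB1 -e invrK.
  by rewrite !mulrA divrr ?SU2_unit// mul1r mulrK// SU2_unit.
Qed.

Lemma expq_sin0 u Q Q' : sin u = 0 -> expq u Q = expq u Q'.
Proof. by rewrite /expq => ->; rewrite !scale0r. Qed.

(** A vanishing sine makes its factor [1] or [-1], whatever the axis, so that only the other axis
    has to be moved. The product in the hypothesis covers this together with the case of equal dot
    products. *)
Lemma expq_pair_conj u v A B A' B' : pure_unit A -> pure_unit B ->
  pure_unit A' -> pure_unit B' ->
  sin u * sin v * (dotq A B - dotq A' B') = 0 ->
  conj_pair (expq u A, expq v B) (expq u A', expq v B').
Proof.
move=> hA hB hA' hB' /eqP; rewrite !mulf_eq0 subr_eq0 => /orP[/orP[]|] /eqP e.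
(* A single axis is moved by applying the statement for pairs to that axis repeated, where both dot
   products are 1. *)
- have [g [hg _ ->]] := pure_unit_pair_conj hB hB hB' hB'
    (etrans (dotqq hB) (esym (dotqq hB'))).
  exists g; split=> //=; rewrite !expq_conjr//; congr (_, _); exact: expq_sin0.
- have [g [hg _ ->]] := pure_unit_pair_conj hA hA hA' hA'
    (etrans (dotqq hA) (esym (dotqq hA'))).
  exists g; split=> //=; rewrite !expq_conjr//; congr (_, _); exact: expq_sin0.
- have [g [hg -> ->]] := pure_unit_pair_conj hA hB hA' hB' e.
  by exists g; split=> //=; rewrite !expq_conjr.
Qed.

Lemma qre_expq_prod (a b : int) u v A B : pure_unit A -> pure_unit B ->
  qre (expq u A ^ a * expq v B ^ b) =
    (chebT a).[cos u] * (chebT b).[cos v]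
    - sin u * sin v * (chebS a).[cos u] * (chebS b).[cos v] * dotq A B.
Proof.
move=> hA hB; rewrite !expq_exprz// !expqE// /dotq /= !chebTE !chebSE.
ring.
Qed.

Lemma chebTN (n : int) : chebT (- n) = chebT n :> {poly R}.
Proof. by rewrite /chebT abszN. Qed.

Lemma chebSN (n : int) : chebS (- n) = - chebS n :> {poly R}.
Proof. by case: n => [[|n]|n] //=; rewrite ?oppr0 ?opprK. Qed.

Lemma commute_qi M : M * qi = qi * M -> qim2 M = 0 /\ qim3 M = 0.
Proof. by case: M => a b c d -[/= _ _ h1 h2]; split; lra. Qed.

Lemma commute_of_qi M N : M * qi = qi * M -> N * qi = qi * N -> M * N = N * M.
Proof.
move=> /commute_qi + /commute_qi; case: M N => a b c d [a' b' c' d'] /=.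
by move=> [-> ->] [-> ->]; congr Quat => /=; ring.
Qed.

(* Conjugation by [e^{a i}] rotates the (i, j, k)-space about the i-axis, so it
   keeps a half-plane bounded by that axis only when it is trivial on it. *)
Lemma half_plane_rigid g (b c b' c' : R) : SU2 g -> g * qi = qi * g ->
  0 <= c -> 0 <= c' -> g * Quat 0 b c 0 * g^-1 = Quat 0 b' c' 0 ->
  c = 0 \/ g = 1 \/ g = -1.
Proof.
move=> hg /commute_qi; case: g hg => g0 g1 g2 g3 hg /= [e2 e3] c_ge0 c'_ge0.
rewrite e2 e3 in hg *; rewrite (SU2_inv hg) => -[/=].
move: hg; rewrite /SU2 /qnorm2 /= => hg.
move=> _ _ h2 h3; have [->|c0] := eqVneq c 0; [by left|right].
(* The k-component reads [2 g0 g1 c = 0] and the j-component [(g0^2 - g1^2) c = c']. With [c > 0],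
   taking [g0 = 0] would make [c'] negative. *)
have {}h3 : g0 * g1 = 0 by apply: (mulfI c0); lra.
have {}h2 : (g0 ^+ 2 - g1 ^+ 2) * c = c' by lra.
have cp : 0 < c by rewrite lt_neqAle eq_sym c0.
have : 0 <= g0 ^+ 2 - g1 ^+ 2 by rewrite -(pmulr_lge0 _ cp) h2.
move=> h4; move/eqP: h3; rewrite mulf_eq0 => /orP[]/eqP e.
  by exfalso; move: hg h4; rewrite e => ? ?; have := sqr_ge0 g1; lra.
have : (g0 - 1) * (g0 + 1) = 0 by rewrite e in hg; lra.
move=> /eqP; rewrite mulf_eq0 => /orP[]/eqP h; [left|right].
  have -> : g0 = 1 by lra.
  by rewrite e.
have -> : g0 = -1 by lra.
by rewrite e; congr Quat => /=; ring.
Qed.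

End Pairs.

(** * Rigidity of [V] under conjugation, and the trace equations of a fiber *)

Section Fibers.
Variables (R : realType) (p q r s : int).
Implicit Types (Q A B M N g : quat R) (u v t x y : R) (w : quat R * quat R).

Lemma acos_itv x : `|x| <= 1 -> 0 <= acos x <= pi.
Proof. by rewrite ler_norml => h; rewrite acos_ge0// acos_lepi. Qed.

Lemma cos_acos x : `|x| <= 1 -> cos (acos x) = x.
Proof. by rewrite ler_norml => h; rewrite acosK. Qed.

Lemma sqrt_sin_acos x y : `|x| <= 1 -> `|y| <= 1 ->
  Num.sqrt ((1 - x ^+ 2) * (1 - y ^+ 2)) = sin (acos x) * sin (acos y).
Proof.
rewrite !ler_norml => hx hy; rewrite !sin_acos// -sqrtrM//.
by rewrite subr_ge0 -real_normK ?num_real// expr_le1// ler_norml.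
Qed.

(** The first word is [i] for both pairs, so [g] centralizes [i]; the second words lie in the
    half-plane of [half_plane_rigid]. Either [g] is [1] or [-1], or the second word is [i] or [-i].
    In the latter case [M] and [N] commute, hence commute with the word [i] in them, and all of [g],
    [M], [N] lie in the commutative centralizer of [i]. *)
Lemma conj_pair_rigid g M N M' N' : SU2 M -> SU2 N ->
  V p q r s (M, N) -> V p q r s (M', N') -> SU2 g ->
  M' = g * M * g^-1 -> N' = g * N * g^-1 ->
  (N ^ (- r) * M ^ s = qi \/ N ^ (- r) * M ^ s = - qi -> M * N = N * M) ->
  (M, N) = (M', N').
Proof.
move=> hM hN [_ _ /= hA [t ht hB]] [_ _ /= hA' [t' ht' hB']] hg eM eN hc.
move: hA' hB'; rewrite eM eN !exprz_conjr// -!conjrM// hA hB.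
move=> gi gB.
have gqi : g * qi = qi * g by rewrite -[in RHS]gi mulrVK// SU2_unit.
rewrite !expq_qk_qi in gB.
have [st0|[g1|g1]] :=
  half_plane_rigid hg gqi (sin_ge0_pi ht) (sin_ge0_pi ht') gB.
- have MN : M * N = N * M.
    apply: hc; rewrite hB expq_qk_qi st0.
    have := cos2Dsin2 t; rewrite st0 expr0n/= addr0 => /eqP.
    rewrite sqrf_eq1 => /orP[]/eqP ->; [by left|right].
    by congr Quat; rewrite oppr0.
  have uM := SU2_unit hM; have uN := SU2_unit hN.
  have cMN : GRing.comm M N by [].
  have cM : M * qi = qi * M.
    rewrite -hA; apply/commrM; first exact/commrXz/commr_refl.
    exact/commrXz.
  have cN : N * qi = qi * N.
    rewrite -hA; apply/commrM; last exact/commrXz/commr_refl.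
    exact/commrXz/commr_sym.
  rewrite (commute_of_qi gqi cM) (commute_of_qi gqi cN).
  by rewrite !mulrK ?SU2_unit.
- by rewrite g1 invr1 !mul1r !mulr1.
- by rewrite g1 invrN invr1 !mulN1r !mulrN1 !opprK.
Qed.

(** Traceless words are pure unit quaternions, and [pure_unit_frame] puts them in the position that
    [V] requires. *)
Lemma conj_in_V M N : SU2 M -> SU2 N ->
  qre (M ^ (s + p) * N ^ (q - r)) = 0 -> qre (N ^ (- r) * M ^ s) = 0 ->
  exists2 g, SU2 g & V p q r s (g * M * g^-1, g * N * g^-1).
Proof.
move=> hM hN reA reB.
have hA : pure_unit (M ^ (s + p) * N ^ (q - r)).
  by split=> //; apply: SU2M; exact: SU2_exprz.
have hB : pure_unit (N ^ (- r) * M ^ s).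
  by split=> //; apply: SU2M; exact: SU2_exprz.
have [g [hg gA gB]] := pure_unit_frame hA hB.
exists g => //; split=> /=; [exact: SU2_conjr|exact: SU2_conjr|..].
  by rewrite !exprz_conjr// -conjrM.
exists (acos (dotq (M ^ (s + p) * N ^ (q - r)) (N ^ (- r) * M ^ s))).
  by apply: acos_itv; rewrite ler_norml dotq_bound.
by rewrite !exprz_conjr// -conjrM.
Qed.

(** On [[0, pi]] an angle is recovered from its cosine by [acos], so only the axes stay unknown. The
    bounds on [x] and [y] are recorded because [acos] inverts [cos] only there. *)
Lemma fiberE x y w : fiber p q r s x y w <-> exists A B,
  [/\ `|x| <= 1, `|y| <= 1, pure_unit A, pure_unit B &
      w = (expq (acos x) A, expq (acos y) B) /\ V p q r s w].
Proof.
split=> [[hV [u [v [A [B [hu hv hA hB [ew [ex ey]]]]]]]]|].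
- have uK : acos x = u by rewrite -ex cosK// in_itv.
  have vK : acos y = v by rewrite -ey cosK// in_itv.
  exists A, B; rewrite uK vK -ex -ey; rewrite ew in hV *.
  by split; rewrite ?ler_norml ?cos_geN1 ?cos_le1.
- move=> [A [B [hx hy hA hB [ew hV]]]]; split=> //.
  by exists (acos x), (acos y), A, B; rewrite !cos_acos// !acos_itv.
Qed.

Lemma num_den_traces x y A B : `|x| <= 1 -> `|y| <= 1 ->
  pure_unit A -> pure_unit B ->
  let M := expq (acos x) A in let N := expq (acos y) B in
  qre (M ^ (s + p) * N ^ (q - r)) =
    num1 p q r s x y - den1 p q r s x y * dotq A B /\
  qre (N ^ (- r) * M ^ s) = num2 r s x y - den2 r s x y * dotq A B.
Proof.
move=> hx hy hA hB M N; rewrite [in X in _ /\ X]qre_mulC !qre_expq_prod//.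
rewrite !cos_acos// /num1 /den1 /num2 /den2 sqrt_sin_acos//.
Qed.

Lemma V_traces x y A B : `|x| <= 1 -> `|y| <= 1 -> pure_unit A -> pure_unit B ->
  V p q r s (expq (acos x) A, expq (acos y) B) ->
  num1 p q r s x y = den1 p q r s x y * dotq A B /\
  num2 r s x y = den2 r s x y * dotq A B.
Proof.
move=> hx hy hA hB [_ _ /= eA [t _ eB]].
have [] := num_den_traces hx hy hA hB; rewrite eA eB (pure_unit_expq_qi t).2 /=.
by move=> /eqP + /eqP; rewrite ![0 == _]eq_sym !subr_eq0 => /eqP -> /eqP ->.
Qed.

(** A converse to [V_traces]: the two equations make both words traceless, and a conjugate of the
    pair then lies in [V]. *)
Lemma fiber_of_traces x y A B : `|x| <= 1 -> `|y| <= 1 ->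
  pure_unit A -> pure_unit B ->
  num1 p q r s x y = den1 p q r s x y * dotq A B ->
  num2 r s x y = den2 r s x y * dotq A B ->
  fiber p q r s x y !=set0.
Proof.
move=> hx hy hA hB e1 e2.
have [] := num_den_traces hx hy hA hB.
rewrite e1 e2 !subrr => h1 h2.
have [g hg hV] := conj_in_V (SU2_expq_pure _ hA) (SU2_expq_pure _ hB) h1 h2.
exists (g * expq (acos x) A * g^-1, g * expq (acos y) B * g^-1).
apply/fiberE; exists (g * A * g^-1), (g * B * g^-1); split=> //.
- exact: pure_unit_conjr.
- exact: pure_unit_conjr.
- by split=> //; rewrite !expq_conjr.
Qed.

Lemma fiber_rigid x y w w' : fiber p q r s x y w -> fiber p q r s x y w' ->
  conj_pair w w' ->
  (w.2 ^ (- r) * w.1 ^ s = qi \/ w.2 ^ (- r) * w.1 ^ s = - qi ->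
     w.1 * w.2 = w.2 * w.1) -> w = w'.
Proof.
case: w w' => M N [M' N'] [hV _] [hV' _] [g [hg [eM eN]]].
have [hM hN _ _] := hV.
exact: conj_pair_rigid eM eN.
Qed.

(* Off the common zeros of the denominators, a trace equation determines the
   angle between the two axes, hence the pair up to conjugation. *)
Lemma fiber_conj x y w w' :
  den1 p q r s x y != 0 \/ den2 r s x y != 0 \/
    Num.sqrt ((1 - x ^+ 2) * (1 - y ^+ 2)) = 0 ->
  fiber p q r s x y w -> fiber p q r s x y w' -> conj_pair w w'.
Proof.
move=> hd /fiberE[A [B [hx hy hA hB [-> hV]]]].
move=> /fiberE[A' [B' [_ _ hA' hB' [-> hV']]]].
apply: expq_pair_conj => //; apply/eqP; rewrite mulf_eq0 subr_eq0.
have [e1 e2] := V_traces hx hy hA hB hV.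
have [e1' e2'] := V_traces hx hy hA' hB' hV'.
rewrite -sqrt_sin_acos//; case: hd => [d0|[d0|->]]; last by rewrite eqxx.
- by apply/orP; right; apply/eqP/(mulfI d0); rewrite -e1 -e1'.
- by apply/orP; right; apply/eqP/(mulfI d0); rewrite -e2 -e2'.
Qed.

End Fibers.

(** * Pillowcase coordinates and their cosines *)

Section Pillowcase.
Variable R : realType.
Implicit Types (Q A B M N g : quat R) (u v t x y gam the : R)
  (w : quat R * quat R).

Lemma cos_sin_surj (a b : R) : a ^+ 2 + b ^+ 2 = 1 ->
  exists t, cos t = a /\ sin t = b.
Proof.
move=> h; have a1 : -1 <= a <= 1.
  by have := sqr_ge0 b => ?; apply/andP; split; nra.
have cosa : cos (acos a) = a by rewrite acosK// in_itv.
have : (sin (acos a) - b) * (sin (acos a) + b) = 0.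
  by rewrite -subr_sqr sin2cos2 cosa -h; ring.
move=> /eqP; rewrite mulf_eq0 => /orP[]/eqP e;
  [exists (acos a)|exists (- acos a)].
  by split=> //; lra.
by rewrite cosN sinN; split=> //; lra.
Qed.

Lemma pure_unitV Q : pure_unit Q -> Q^-1 = - Q.
Proof.
move=> hQ; rewrite (SU2_inv hQ.1).
by case: Q hQ => ????[_ /= ->]; congr Quat; rewrite oppr0.
Qed.

Lemma qreN Q : qre (- Q) = - qre Q. Proof. by []. Qed.

Lemma pillow_relation A B C D : pure_unit C -> B * A = C * D -> D = - C * B * A.
Proof.
move=> hC e; rewrite -mulrA e mulrA -pure_unitV//.
by rewrite mulVr ?mul1r// (SU2_unit hC.1).
Qed.

(** With [A] at [i] and [B] in the (i, j)-plane, the relation expresses [D] through the other three,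
    and tracelessness of [D] confines [C] to the same plane unless [B] is [A] or [-A]. In that case
    [A] and [C] are put in normal position instead. *)
Lemma pillow_point_exists (f : S2rep R) :
  exists gam the, pillow_point f gam the.
Proof.
case: f => A B C D [hA hB hC hD] e /=; rewrite /pillow_point /=.
have [g [hg gA gB]] := pure_unit_frame hA hB.
move: (acos _) gB => gam gB.
have [h [hh [hA' [k hB'] [t hC']]]] : exists h, SU2 h /\ [/\ h * A * h^-1 = qi,
    exists k, h * B * h^-1 = expq k qk * qi &
    exists t, h * C * h^-1 = expq t qk * qi].
  have [sg0|sg0] := eqVneq (sin gam) 0; last first.
    exists g; split=> //; split=> //; first by exists gam.
    have gC := pure_unit_conjr hg hC; have gD := pure_unit_conjr hg hD.
    have := pillow_relation gC (etrans (esym (conjrM _ _ hg))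
      (etrans (congr1 (fun z => g * z * g^-1) e) (conjrM _ _ hg))).
    move: gC gD.1; rewrite gA gB expq_qk_qi.
    move: (g * C * g^-1) => [c0 c1 c2 c3].
    move=> [+ /= c00] _ eD; rewrite c00 /SU2 /qnorm2 /= => c12.
    have := gD.2; rewrite eD c00 /= => h0.
    (* The real part of [D] is [- c3 * sin gam]. *)
    have c30 : c3 = 0 by apply: (mulIf sg0); lra.
    have [t [ct st]] : exists t, cos t = c1 /\ sin t = c2.
      by apply: cos_sin_surj; rewrite c30 in c12; lra.
    by exists t; rewrite expq_qk_qi ct st c30.
  have eB : B = cos gam *: A.
    apply: (conjr_inj hg); rewrite gB -scaleqAr -scalerAl gA expq_qk_qi sg0.
    by congr Quat => /=; ring.
  have [h [hh hA' hC']] := pure_unit_frame hA hC.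
  exists h; split=> //; split=> //; last by exists (acos (dotq A C)).
  exists gam; rewrite eB -scaleqAr -scalerAl hA' expq_qk_qi sg0.
  by congr Quat => /=; ring.
exists k, t, h; split=> //.
have gC := pure_unit_conjr hh hC.
(* The relation determines the image of [D], and the subtraction formulas give its angle [t - k]. *)
rewrite (pillow_relation gC (etrans (esym (conjrM _ _ hh))
      (etrans (congr1 (fun z => h * z * h^-1) e) (conjrM _ _ hh)))).
rewrite hA' hB' hC' !expq_qk_qi cosB sinB.
by congr Quat => /=; ring.
Qed.

Variables (p q r s : int).

(** Keeping [dotq A B] in the formulas lets one computation serve every non-empty fiber: the dot
    product becomes [tau] or [cos t], or is multiplied by zero on the boundary. *)
Lemma image_satisfies_fiber x y A B : `|x| <= 1 -> `|y| <= 1 ->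
  pure_unit A -> pure_unit B ->
  V p q r s (expq (acos x) A, expq (acos y) B) ->
  let w := Num.sqrt ((1 - x ^+ 2) * (1 - y ^+ 2)) in
  image_satisfies p q r s (expq (acos x) A, expq (acos y) B) (fun gam the =>
    cos gam = - (chebT (2 * s + p)).[x] * (chebT (q - 2 * r)).[y]
      + w * (chebS (2 * s + p)).[x] * (chebS (q - 2 * r)).[y] * dotq A B /\
    cos (gam - the) = (chebT p).[x] * (chebT q).[y]
      - w * (chebS p).[x] * (chebS q).[y] * dotq A B).
Proof.
move=> hx hy hA hB hV w; rewrite /w sqrt_sin_acos// {w}.
have trMN a b := qre_expq_prod a b (acos x) (acos y) hA hB.
move: hV trMN; rewrite !cos_acos//.
move: (sin _ * sin _) (SU2_expq_pure (acos x) hA) (SU2_expq_pure (acos y) hB).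
move: (expq _ A) (expq _ B) => M N w hM hN hV trMN.
have [_ _ eA [t _ eB]] := hV; rewrite /= in eA eB.
have uM := SU2_unit hM; have uN := SU2_unit hN.
have hMe n : SU2 (M ^ n) by exact: SU2_exprz.
have hNe n : SU2 (N ^ n) by exact: SU2_exprz.
pose a := M ^ (s + p) * N ^ (q - r).
pose b := N ^ (- r) * M ^ s.
pose c := N ^ (- r) * M ^ (s + p) * N ^ q.
pose d := N ^ (- q) * M ^ s * N ^ (q - r).
have ha : pure_unit a by rewrite /a eA; exact: pure_unit_qi.
have hb : pure_unit b by rewrite /b eB; exact: pure_unit_expq_qi.
(* [c] and [d] are conjugate to [a] and [b] by powers of [N]; cyclicity of the real part shows that
   they are traceless. *)
have hc : pure_unit c.
  split; first by do 2?apply: SU2M.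
  by rewrite qre_mulC mulrA -exprzDr// qre_mulC ha.2.
have hd : pure_unit d.
  split; first by do 2?apply: SU2M.
  by rewrite qre_mulC !mulrA -exprzDr// addrAC subrr add0r hb.2.
have eba : b * a = N ^ (- r) * M ^ (2 * s + p) * N ^ (q - r).
  rewrite /a /b !mulrA -[_ * M ^ s * _]mulrA -exprzDr//.
  by congr (_ * M ^ _ * _); ring.
have e : b * a = c * d.
  rewrite eba /c /d !mulrA -[_ * N ^ q * _]mulrA -exprzDr// subrr expr0z mulr1.
  rewrite -[_ * M ^ (s + p) * _]mulrA -exprzDr//.
  by congr (_ * M ^ _ * _); ring.
split.
  have [gam [the h]] := pillow_point_exists (Build_S2rep (And4 ha hb hc hd) e).
  by exists gam, the, (Build_S2rep (And4 ha hb hc hd) e).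
move=> gam the [f [/= fa fb fc fd] [g [hg ga gb gc gd]]].
rewrite {}fa in ga; rewrite {}fb in gb; rewrite {}fc in gc.
split.
  have : qre (g * (b * a) * g^-1) = - cos gam.
    by rewrite conjrM// ga gb expq_qk_qi /=; ring.
  rewrite qre_conjr// eba qre_mulC mulrA -exprzDr// qre_mulC trMN.
  have -> : q - r - r = q - 2 * r by ring.
  lra.
have : qre (g * (b * c) * g^-1) = - cos (gam - the).
  by rewrite conjrM// gb gc !expq_qk_qi cosB /=; ring.
rewrite qre_conjr//.
(* Passing to [c^-1] lets powers cancel: up to cyclic rotation [b * c^-1] is [M^(-p) N^(-q)]. As
   [chebT] is even and [chebS] odd in the index, the two signs cancel. *)
have -> : b * c = - (b * c^-1) by rewrite pure_unitV// mulrN opprK.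
have -> : b * c^-1 = N ^ (- r) * M ^ s * N ^ (- q) * M ^ (- (s + p)) * N ^ r.
  have u n m : N ^ n * M ^ m \is a GRing.unit by exact/SU2_unit/SU2M.
  rewrite /c !invrM ?unitrXz//.
  by rewrite !invr_expz opprK !mulrA.
rewrite qreN => /oppr_inj.
rewrite qre_mulC !mulrA -exprzDr// subrr expr0z mul1r.
rewrite qre_mulC !mulrA -exprzDr// trMN.
have -> : - (s + p) + s = - p by ring.
rewrite !chebTN !chebSN !hornerN.
lra.
Qed.

End Pillowcase.

(** * The explicit arc over a point of [Z1] inside the open square *)

Section Arcs.
Variable R : realType.
Implicit Types (Q A B M N g : quat R) (u v t x y gam the : R)
  (w : quat R * quat R).

Lemma sin_mulz_eq0 (n : int) u : sin u = 0 -> sin (n%:~R * u) = 0.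
Proof. by rewrite chebSE => ->; rewrite mul0r. Qed.

Lemma sin_add_eq0 u v : sin u = 0 -> sin v = 0 -> sin (u + v) = 0.
Proof. by rewrite sinD => -> ->; rewrite mul0r mulr0 addr0. Qed.

(** The zeros of [sin] form a subgroup of the reals, and [u = k (a u) + l (b u)]. *)
Lemma sin_eq0_bezout (a b k l : int) u : k * a + l * b = 1 ->
  sin (a%:~R * u) = 0 -> sin (b%:~R * u) = 0 -> sin u = 0.
Proof.
move=> e sa sb; rewrite -[u]mul1r -[1]/(1%:~R) -e intrD !intrM mulrDl -!mulrA.
by apply: sin_add_eq0; exact: sin_mulz_eq0.
Qed.

Lemma sin_acos_gt0 x : `|x| < 1 -> 0 < sin (acos x).
Proof.
rewrite ltr_norml => /andP[x0 x1].
rewrite sin_acos ?(ltW x0) ?(ltW x1)//.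
by rewrite sqrtr_gt0; nra.
Qed.

(** For [e = -1] the angle is [pi - t]. This absorbs a sign without leaving the half-circle with
    non-negative sine. *)
Lemma cos_sign_surj (e : R) t : e ^+ 2 = 1 -> 0 <= t <= pi ->
  exists t', [/\ 0 <= t' <= pi, cos t' = e * cos t & sin t' = sin t].
Proof.
move=> /eqP; rewrite sqrf_eq1 => /orP[]/eqP -> /andP[t0 tpi].
  by exists t; rewrite mul1r t0 tpi.
exists (pi - t); rewrite subr_ge0 tpi gerBl t0 cosB sinB cospi sinpi.
by split=> //; ring.
Qed.

Lemma sqr_sign (a b : R) : a ^+ 2 = 1 -> b ^+ 2 = 1 -> (a * b) ^+ 2 = 1.
Proof. by rewrite exprMn => -> ->; rewrite mulr1. Qed.

Lemma cos_sqr_of_sin0 u : sin u = 0 -> cos u ^+ 2 = 1.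
Proof. by move=> h; have := cos2Dsin2 u; rewrite h expr0n addr0. Qed.

Lemma sin_sqr_of_cos0 u : cos u = 0 -> sin u ^+ 2 = 1.
Proof. by move=> h; have := cos2Dsin2 u; rewrite h expr0n add0r. Qed.

Variables (p q r s : int).

Definition words_are_axes x y (b : bool) (e1 e2 : R) : Prop :=
  forall A B, pure_unit A -> pure_unit B ->
    let M := expq (acos x) A in let N := expq (acos y) B in
    M ^ (s + p) * N ^ (q - r) = e1 *: (if b then B else A) /\
    N ^ (- r) * M ^ s = e2 *: (if b then A else B).

(* Each of [M^(s+p) N^(q-r)] and [N^(-r) M^s] is, up to sign, one of the two
   axes; by the Bezout relation they cannot be the same one. *)
Lemma arc_signs x y : p * r + q * s = 1 -> arc_case p q r s x y ->
  exists (b : bool) (e1 e2 : R),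
    [/\ e1 ^+ 2 = 1, e2 ^+ 2 = 1 & words_are_axes x y b e1 e2].
Proof.
move=> bezout [hx hy [_ [/= d1 n1] [d2 n2]]].
have hx' := ltW hx; have hy' := ltW hy.
move: d1 n1 d2 n2; rewrite /den1 /num1 /den2 /num2 sqrt_sin_acos//.
rewrite /words_are_axes.
move: (sin_acos_gt0 hx) (sin_acos_gt0 hy) (cos_acos hx') (cos_acos hy').
move: (acos x) (acos y) => u v su sv <- <- d1 n1 d2 n2.
have {}n1 : cos ((s + p)%:~R * u) * cos ((q - r)%:~R * v) = 0.
  by rewrite !chebTE.
have {}d1 : sin ((s + p)%:~R * u) * sin ((q - r)%:~R * v) = 0.
  by rewrite !chebSE mulrACA mulrA.
have {}n2 : cos (s%:~R * u) * cos ((- r)%:~R * v) = 0 by rewrite !chebTE.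
have {}d2 : sin (s%:~R * u) * sin ((- r)%:~R * v) = 0.
  by rewrite !chebSE mulrACA mulrA.
have nz (a b : R) : a * b = 0 -> a = 0 \/ b = 0.
  by move/eqP; rewrite mulf_eq0 => /orP[]/eqP; [left|right].
have nsc (z : R) : sin z = 0 -> cos z = 0 -> False.
  by move=> s0 /sin_sqr_of_cos0/eqP; rewrite s0 expr0n eq_sym oner_eq0.
have su0 : sin u <> 0 by move: su => /[swap] ->; rewrite ltxx.
have sv0 : sin v <> 0 by move: sv => /[swap] ->; rewrite ltxx.
(* A zero cosine makes one power [A] or [-A], and a zero sine makes the other power [1] or [-1], so
   the order of the factors is immaterial. *)
have word (a b : int) A B : pure_unit A -> pure_unit B ->
    cos (a%:~R * u) = 0 -> sin (b%:~R * v) = 0 ->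
    expq u A ^ a * expq v B ^ b = (sin (a%:~R * u) * cos (b%:~R * v)) *: A /\
    expq v B ^ b * expq u A ^ a = (sin (a%:~R * u) * cos (b%:~R * v)) *: A.
  move=> hA hB c0 s0; rewrite !expq_exprz// !expqE// c0 s0.
  case: A hA => ????[_ /= ->].
  by split; congr Quat => /=; ring.
have word' (a b : int) A B : pure_unit A -> pure_unit B ->
    sin (a%:~R * u) = 0 -> cos (b%:~R * v) = 0 ->
    expq u A ^ a * expq v B ^ b = (cos (a%:~R * u) * sin (b%:~R * v)) *: B /\
    expq v B ^ b * expq u A ^ a = (cos (a%:~R * u) * sin (b%:~R * v)) *: B.
  move=> hA hB s0 c0; rewrite !expq_exprz// !expqE// c0 s0.
  case: B hB => ????[_ /= ->].
  by split; congr Quat => /=; ring.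
case/nz: n1 => [cu|cv].
  have sv1 : sin ((q - r)%:~R * v) = 0 by case/nz: d1 => [/nsc/(_ cu)|].
  case/nz: n2 => [cu'|cv'].
    have sv2 : sin ((- r)%:~R * v) = 0 by case/nz: d2 => [/nsc/(_ cu')|].
    (* Both words would lie on the axis [A]. The coefficients come from [s (q - r) + (- p - s) (- r)
       = p r + q s = 1], which forces [sin v = 0]. *)
    case: sv0; apply: (@sin_eq0_bezout _ _ s (- p - s) _ _ sv1 sv2).
    by rewrite -bezout; ring.
  have su2 : sin (s%:~R * u) = 0 by case/nz: d2 => [|/nsc/(_ cv')].
  exists false, (sin ((s + p)%:~R * u) * cos ((q - r)%:~R * v)),
    (cos (s%:~R * u) * sin ((- r)%:~R * v)).
  split; [exact: sqr_sign (sin_sqr_of_cos0 cu) (cos_sqr_of_sin0 sv1)|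
          exact: sqr_sign (cos_sqr_of_sin0 su2) (sin_sqr_of_cos0 cv')|].
  move=> A B hA hB /=; split; first by have [] := word _ _ _ _ hA hB cu sv1.
  by have [] := word' _ _ _ _ hA hB su2 cv'.
have su1 : sin ((s + p)%:~R * u) = 0 by case/nz: d1 => [|/nsc/(_ cv)].
case/nz: n2 => [cu'|cv']; last first.
  have su2 : sin (s%:~R * u) = 0 by case/nz: d2 => [|/nsc/(_ cv')].
  (* Here both words would lie on [B], and [r (s + p) + (q - r) s = 1] forces [sin u = 0]. *)
  case: su0; apply: (@sin_eq0_bezout _ _ r (q - r) _ _ su1 su2).
  by rewrite -bezout; ring.
have sv2 : sin ((- r)%:~R * v) = 0 by case/nz: d2 => [/nsc/(_ cu')|].
exists true, (cos ((s + p)%:~R * u) * sin ((q - r)%:~R * v)),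
  (sin (s%:~R * u) * cos ((- r)%:~R * v)).
split; [exact: sqr_sign (cos_sqr_of_sin0 su1) (sin_sqr_of_cos0 cv)|
        exact: sqr_sign (sin_sqr_of_cos0 cu') (cos_sqr_of_sin0 sv2)|].
move=> A B hA hB /=; split; first by have [] := word' _ _ _ _ hA hB su1 cv.
by have [] := word _ _ _ _ hA hB cu' sv2.
Qed.

Definition fixed_axis (e1 : R) : quat R := Quat 0 e1 0 0.
(** For signs [e1] and [e2], the factor [e1] makes the dot product with [fixed_axis e1] equal to
    [cos t], and [e2] makes the j-component of [e2 *: moving_axis e1 e2 t] equal to [sin t],
    non-negative as [V] demands. *)
Definition moving_axis (e1 e2 t : R) : quat R :=
  Quat 0 (e1 * cos t) (e2 * sin t) 0.

Definition arc_path x y (b : bool) (e1 e2 t : R) : quat R * quat R :=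
  (expq (acos x) (if b then moving_axis e1 e2 t else fixed_axis e1),
   expq (acos y) (if b then fixed_axis e1 else moving_axis e1 e2 t)).

Lemma pure_unit_fixed_axis e1 : e1 ^+ 2 = 1 -> pure_unit (fixed_axis e1).
Proof. by move=> h; split=> //; rewrite /SU2 /qnorm2 /=; lra. Qed.

Lemma pure_unit_moving_axis e1 e2 t : e1 ^+ 2 = 1 -> e2 ^+ 2 = 1 ->
  pure_unit (moving_axis e1 e2 t).
Proof.
move=> h1 h2; split=> //; rewrite /SU2 /qnorm2 /= !exprMn h1 h2.
by have := cos2Dsin2 t; lra.
Qed.

Lemma continuous_pair (T U W : topologicalType) (f : T -> U) (g : T -> W)
    (t : T) :
  {for t, continuous f} -> {for t, continuous g} ->
  {for t, continuous (fun z => (f z, g z))}.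
Proof. exact: cvg_pair. Qed.

Lemma arc_path_continuous x y b e1 e2 :
  path_continuous `[0, pi] (arc_path x y b e1 e2).
Proof.
apply: continuous_subspaceT => t.
have cM (k : R) (h : R -> R) : {for t, continuous h} ->
    {for t, continuous (fun z => k * h z)}.
  by move=> cf; apply: cvgM cf; exact: cvg_cst.
have cc (T : topologicalType) (k : T) : {for t, continuous (fun _ : R => k)}.
  exact: cvg_cst.
have cm u : {for t,
    continuous (fun z => quat_tuple (expq u (moving_axis e1 e2 z)))}.
  have -> : (fun z => quat_tuple (expq u (moving_axis e1 e2 z))) =
      (fun z => (cos u, sin u * (e1 * cos z), sin u * (e2 * sin z), 0)).
    by apply/funext => z; rewrite /quat_tuple /=; congr (_, _, _, _); ring.
  have c1 := cM (sin u) _ (cM e1 _ (@continuous_cos R t)).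
  have c2 := cM (sin u) _ (cM e2 _ (@continuous_sin R t)).
  have c3 := continuous_pair (continuous_pair (cc R (cos u)) c1) c2.
  have := continuous_pair c3 (cc R 0); exact.
have cf u := cc (R * R * R * R)%type (quat_tuple (expq u (fixed_axis e1))).
case: b.
  have := continuous_pair (cm (acos x)) (cf (acos y)); exact.
have := continuous_pair (cf (acos x)) (cm (acos y)); exact.
Qed.

(** The i-component on the moving axis is a nonzero multiple of [cos t], and [cos] is injective on
    [[0, pi]]. *)
Lemma arc_path_inj x y b e1 e2 : e1 ^+ 2 = 1 -> `|x| < 1 -> `|y| < 1 ->
  {in `[0, pi] &, injective (arc_path x y b e1 e2)}.
Proof.
move=> h1 hx hy t t' ht ht' e; apply: cos_inj => //.
have e10 : e1 != 0 by rewrite -sqrf_eq0 h1 oner_eq0.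
have nz (z : R) : `|z| < 1 -> sin (acos z) != 0.
  by move=> h; apply: lt0r_neq0; exact: sin_acos_gt0.
have key (z : R) : `|z| < 1 -> qim1 (expq (acos z) (moving_axis e1 e2 t)) =
    qim1 (expq (acos z) (moving_axis e1 e2 t')) -> cos t = cos t'.
  move=> /nz z0 /= e'; apply: (mulfI e10); apply: (mulfI z0); lra.
have E := congr1 (fun w => qim1 (if b then w.1 else w.2)) e.
by case: b e E => _ E; [exact: key hx E|exact: key hy E].
Qed.

Lemma arc_path_fiber x y b e1 e2 t : `|x| < 1 -> `|y| < 1 ->
  e1 ^+ 2 = 1 -> e2 ^+ 2 = 1 ->
  words_are_axes x y b e1 e2 ->
  0 <= t <= pi -> V p q r s (arc_path x y b e1 e2 t).
Proof.
move=> hx hy h1 h2 word ht.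
have hf := pure_unit_fixed_axis h1; have hm := pure_unit_moving_axis t h1 h2.
have [t' [ht' ct st]] := cos_sign_surj (sqr_sign h1 h2) ht.
have eB : e2 *: moving_axis e1 e2 t = expq t' qk * qi.
  rewrite expq_qk_qi ct st; congr Quat => /=; [ring|ring| |ring].
  by rewrite mulrA -expr2 h2 mul1r.
have eA : e1 *: fixed_axis e1 = qi.
  by congr Quat => /=; [ring|rewrite -expr2|ring|ring].
case: b word => word.
- split; [exact: SU2_expq_pure|exact: SU2_expq_pure|..] => /=.
    by have [-> _] := word _ _ hm hf.
  by exists t' => //; have [_ ->] := word _ _ hm hf.
- split; [exact: SU2_expq_pure|exact: SU2_expq_pure|..] => /=.
    by have [-> _] := word _ _ hf hm.
  by exists t' => //; have [_ ->] := word _ _ hf hm.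
Qed.

End Arcs.

(** * The characterization of [tau] and the cases that a non-empty fiber allows *)

Section Cases.
Variables (R : realType) (p q r s : int).
Implicit Types (Q A B M N g : quat R) (u v t x y gam the : R)
  (w : quat R * quat R).

Lemma arc_path_is_arc x y b e1 e2 : `|x| < 1 -> `|y| < 1 ->
  e1 ^+ 2 = 1 -> e2 ^+ 2 = 1 ->
  words_are_axes p q r s x y b e1 e2 ->
  is_arc (fiber p q r s x y) (arc_path x y b e1 e2).
Proof.
move=> hx hy h1 h2 word; split.
- exact: arc_path_continuous.
- exact: arc_path_inj.
apply/seteqP; split=> [w [t] /=|w].
  rewrite in_itv /= => ht <-; apply/fiberE.
  have hf := pure_unit_fixed_axis h1; have hm := pure_unit_moving_axis t h1 h2.
  have hV := arc_path_fiber hx hy h1 h2 word ht.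
  exists (if b then moving_axis e1 e2 t else fixed_axis e1).
  exists (if b then fixed_axis e1 else moving_axis e1 e2 t).
  by split; rewrite ?ltW//; case: (b).
move=> /fiberE[A [B [_ _ hA hB [-> [_ _ /= eA [t ht eB]]]]]].
have [wA wB] := word A B hA hB; rewrite /= eA in wA; rewrite /= eB in wB.
(* [t] is the angle of the second word; the arc parameter [t'] is [t] or [pi - t] according to the
   sign [e1 * e2]. Multiplying the words by their signs recovers the axes. *)
have [t' [ht' ct st]] := cos_sign_surj (sqr_sign h1 h2) ht.
have eP : (if b then B else A) = fixed_axis e1.
  rewrite -[LHS]scale1r -h1 expr2 -scalerA -wA.
  by congr Quat => /=; ring.
have eP' : (if b then A else B) = moving_axis e1 e2 t'.
  rewrite -[LHS]scale1r -h2 expr2 -scalerA -wB expq_qk_qi /moving_axis ct st.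
  by congr Quat => /=; [ring| |ring]; rewrite !mulrA -expr2 h1 mul1r.
exists t'; first by rewrite /= in_itv.
by rewrite /arc_path -eP -eP'; case: (b).
Qed.

Lemma dotq_arc b e1 e2 t : e1 ^+ 2 = 1 ->
  dotq (if b then moving_axis e1 e2 t else fixed_axis e1)
       (if b then fixed_axis e1 else moving_axis e1 e2 t) = cos t.
Proof.
move=> h; rewrite -[RHS]mul1r -h.
by case: b; rewrite /dotq /=; ring.
Qed.

(** The division-free form survives a zero denominator because [Z0] then makes its numerator vanish
    too. *)
Lemma num_eq_den_tau x y : Z0 p q r s (x, y) ->
  num1 p q r s x y = den1 p q r s x y * tau p q r s x y /\
  num2 r s x y = den2 r s x y * tau p q r s x y.
Proof.
move=> [/= hZ hd h1 h2]; split.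
  have [d1|d1] := eqVneq (den1 p q r s x y) 0; first by rewrite h1// d1 mul0r.
  by rewrite /tau d1 mulrC divfK.
have [d2|d2] := eqVneq (den2 r s x y) 0; first by rewrite h2// d2 mul0r.
by rewrite tau_ratio2// mulrC divfK.
Qed.

Lemma tau_unique x y (c : R) : Z p q r s (x, y) ->
  den1 p q r s x y != 0 \/ den2 r s x y != 0 ->
  num1 p q r s x y = den1 p q r s x y * c ->
  num2 r s x y = den2 r s x y * c -> tau p q r s x y = c.
Proof.
move=> hZ hd e1 e2; have [d1|d1] := eqVneq (den1 p q r s x y) 0.
  have d2 : den2 r s x y != 0 by case: hd => //; rewrite d1 eqxx.
  by rewrite tau_ratio2// e2 mulrAC divff// mul1r.
by rewrite /tau d1 e1 mulrAC divff// mul1r.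
Qed.

(** Eliminate the dot product of the axes from the two trace equations. *)
Lemma fiber_pfun0 x y w : fiber p q r s x y w -> pfun p q r s x y = 0.
Proof.
move=> /fiberE[A [B [hx hy hA hB [-> hV]]]].
have [e1 e2] := V_traces hx hy hA hB hV.
transitivity (num1 p q r s x y * (chebS s).[x] * (chebS (- r)).[y]
  - (chebS (s + p)).[x] * (chebS (q - r)).[y] * num2 r s x y).
  by rewrite /pfun /num1 /num2; ring.
by rewrite e1 e2 /den1 /den2; ring.
Qed.

(** If both denominators vanish, the trace equations kill both numerators and the point is in [Z1].
    Otherwise the common square root is nonzero, so the point is inside the open square, and [tau]
    is the dot product of two unit axes. *)
Lemma fiber_trichotomy x y w : fiber p q r s x y w ->
  [\/ generic_case p q r s x y, arc_case p q r s x y |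
      boundary_case p q r s x y].
Proof.
move=> hw; have hZ := fiber_pfun0 hw.
move: hw => /fiberE[A [B [hx hy hA hB [ew hV]]]]; rewrite ew in hV.
have [e1 e2] := V_traces hx hy hA hB hV.
have [d0|d0] := boolP ((den1 p q r s x y == 0) && (den2 r s x y == 0)).
  move/andP: d0 => -[/eqP d1 /eqP d2].
  have z1 : Z1 p q r s (x, y).
    by split=> //=; split=> //; rewrite ?e1 ?e2 ?d1 ?d2 mul0r.
  have [x1|x1] := eqVneq `|x| 1; first by apply: Or33; split=> //; left.
  have [y1|y1] := eqVneq `|y| 1; first by apply: Or33; split=> //; right.
  by apply: Or32; split=> //; rewrite lt_neqAle ?x1 ?y1.
have hd : den1 p q r s x y != 0 \/ den2 r s x y != 0.
  by apply/orP; rewrite -negb_and.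
have lt1 (z : R) : `|z| <= 1 -> (1 - z ^+ 2 == 0 -> false) -> `|z| < 1.
  move=> hz h; rewrite lt_neqAle hz andbT; apply/eqP => z1.
  by move: h; rewrite -real_normK ?num_real// z1 expr1n subrr eqxx => /(_ isT).
have wn0 : Num.sqrt ((1 - x ^+ 2) * (1 - y ^+ 2)) != 0.
  by case: hd; apply: contra => /eqP; rewrite /den1 /den2 => ->; rewrite !mul0r.
have [hx1 hy1] : `|x| < 1 /\ `|y| < 1.
  split; apply: lt1 => // /eqP z0; move: wn0; rewrite z0 ?mul0r ?mulr0 sqrtr0.
    by rewrite eqxx.
  by rewrite eqxx.
apply: Or31; split=> //.
  by split=> //= d; rewrite ?e1 ?e2 d mul0r.
by rewrite (tau_unique hZ hd e1 e2) ler_norml dotq_bound.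
Qed.

Lemma expq_commute u v A B : pure_unit A -> pure_unit B ->
  sin u * sin v = 0 -> expq u A * expq v B = expq v B * expq u A.
Proof.
move=> hA hB /eqP; rewrite mulf_eq0 => /orP[]/eqP s0.
  by rewrite !expqE// s0; congr Quat => /=; ring.
by rewrite !expqE// s0; congr Quat => /=; ring.
Qed.

End Cases.

(** * The fibers and their pillowcase images, case by case *)

Theorem theorem11p3 (R : realType) (p q r s : int) (p_neq0 : p != 0)
    (q_neq0 : q != 0) (pq_coprime : coprimez p q)
    (bezout : p * r + q * s = 1) :
  (forall (u v : R) (Q Q' : quat R),
     0 <= u <= pi -> 0 <= v <= pi -> pure_unit Q -> pure_unit Q' ->
     V p q r s (expq u Q, expq v Q') -> pfun p q r s (cos u) (cos v) = 0) /\
  (forall x y : R, Z p q r s (x, y) ->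
     let w := Num.sqrt ((1 - x ^+ 2) * (1 - y ^+ 2)) in
     [/\
       (* (1) *)
       generic_case p q r s x y ->
       [/\ single_point_upto_conj r s (fiber p q r s x y),
           (forall MN, fiber p q r s x y MN ->
              conj_pair MN
                (model_pair (acos x) (acos y) (acos (tau p q r s x y)))) &
           (forall MN, fiber p q r s x y MN ->
              image_satisfies p q r s MN (fun gam the =>
                cos gam = - (chebT (2 * s + p)).[x] * (chebT (q - 2 * r)).[y]
                  + w * (chebS (2 * s + p)).[x] * (chebS (q - 2 * r)).[y]
                    * tau p q r s x y /\
                cos (gam - the) = (chebT p).[x] * (chebT q).[y]
                  - w * (chebS p).[x] * (chebS q).[y] * tau p q r s x y))],
       (* (2) *)
       arc_case p q r s x y ->
       exists c : R -> quat R * quat R,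
         [/\ is_arc (fiber p q r s x y) c,
             (forall t, 0 <= t <= pi ->
                conj_pair (c t) (model_pair (acos x) (acos y) t)) &
             (forall t, 0 <= t <= pi ->
                image_satisfies p q r s (c t) (fun gam the =>
                  cos gam = - (chebT (2 * s + p)).[x] * (chebT (q - 2 * r)).[y]
                    + w * (chebS (2 * s + p)).[x] * (chebS (q - 2 * r)).[y]
                      * cos t /\
                  cos (gam - the) = (chebT p).[x] * (chebT q).[y]
                    - w * (chebS p).[x] * (chebS q).[y] * cos t))],
       (* (3) *)
       boundary_case p q r s x y ->
       exists MN, fiber p q r s x y = [set MN] /\
         image_satisfies p q r s MN (fun gam the =>
           cos gam = - (chebT (2 * s + p)).[x] * (chebT (q - 2 * r)).[y] /\
           cos (gam - the) = (chebT p).[x] * (chebT q).[y]) &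
       (* (4) *)
       ~ generic_case p q r s x y -> ~ arc_case p q r s x y ->
       ~ boundary_case p q r s x y -> fiber p q r s x y = set0]).
Proof.
split.
  move=> u v A B hu hv hA hB hV.
  apply: (@fiber_pfun0 _ _ _ _ _ _ _ (expq u A, expq v B)).
  by split=> //; exists u, v, A, B.
move=> x y hZ w; split.
- move=> [hx hy hz0 ht].
  have hx' := ltW hx; have hy' := ltW hy.
  have [e1 e2] := num_eq_den_tau hz0.
  have hd : den1 p q r s x y != 0 \/ den2 r s x y != 0 by case: hz0.
  have hm := pure_unit_expq_qi (acos (tau p q r s x y)).
  have em : dotq qi (expq (acos (tau p q r s x y)) qk * qi) = tau p q r s x y.
    by rewrite dotq_expq_qi cos_acos.
  split.
  + split.
    * by apply: (fiber_of_traces hx' hy' (pure_unit_qi R) hm); rewrite em.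
    * by move=> w1 w2; apply: fiber_conj; case: hd => ?; [left|right; left].
    * move=> w1 w2 h1 h2; apply: (fiber_rigid h1 h2).
      by apply: fiber_conj h1 h2; case: hd => ?; [left|right; left].
  + move=> MN /fiberE[A [B [_ _ hA hB [-> hV]]]].
    have [e1' e2'] := V_traces hx' hy' hA hB hV.
    apply: (expq_pair_conj hA hB (pure_unit_qi R) hm).
    by rewrite em (tau_unique hZ hd e1' e2') subrr mulr0.
  + move=> MN /fiberE[A [B [_ _ hA hB [-> hV]]]].
    have [e1' e2'] := V_traces hx' hy' hA hB hV.
    rewrite (tau_unique hZ hd e1' e2').
    exact: image_satisfies_fiber.
- move=> ha; have [hx hy _] := ha.
  have [b [e1 [e2 [h1 h2 word]]]] := arc_signs bezout ha.
  have hax t : pure_unit (if b then moving_axis e1 e2 t else fixed_axis e1).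
    by case: b {word};
      [exact: pure_unit_moving_axis|exact: pure_unit_fixed_axis].
  have hax' t : pure_unit (if b then fixed_axis e1 else moving_axis e1 e2 t).
    by case: b {word hax};
      [exact: pure_unit_fixed_axis|exact: pure_unit_moving_axis].
  exists (arc_path x y b e1 e2); split; first exact: arc_path_is_arc.
  + move=> t ht; apply: expq_pair_conj => //;
      [exact: pure_unit_qi|exact: pure_unit_expq_qi|].
    by rewrite dotq_arc// dotq_expq_qi subrr mulr0.
  + move=> t ht; rewrite -(dotq_arc b e2 t h1).
    apply: image_satisfies_fiber; rewrite ?ltW//.
    exact: arc_path_fiber.
- move=> [hx hy h1 [_ [/= d1 n1] [d2 n2]]].
  have w0 : w = 0.
    rewrite /w; apply/eqP; rewrite sqrtr_eq0.
    rewrite -(real_normK (num_real x)) -(real_normK (num_real y)).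
    by case: h1 => ->; rewrite expr1n subrr ?mul0r ?mulr0.
  have [MN hMN] : fiber p q r s x y !=set0.
    (* Any axes serve as witnesses, since both trace equations read [0 = 0]. *)
    apply: (fiber_of_traces hx hy (pure_unit_qi R) (pure_unit_qi R)).
      by rewrite n1 d1 mul0r.
    by rewrite n2 d2 mul0r.
  exists MN; split.
    apply/seteqP; split=> [w1 hw1|_ ->//].
    apply: (fiber_rigid hw1 hMN).
      by apply: fiber_conj hw1 hMN; right; right.
    (* On the boundary one of the two quaternions is [1] or [-1], so they commute and the fiber is a
       point without passing to conjugacy classes. *)
    move=> _; move: hw1 => /fiberE[A [B [_ _ hA hB [ew hV]]]].
    by rewrite ew /=; apply: expq_commute; rewrite // -sqrt_sin_acos.
  move: hMN => /fiberE[A [B [_ _ hA hB [-> hV]]]].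
  have := image_satisfies_fiber hx hy hA hB hV.
  rewrite -/w w0 => -[hex hall]; split=> // gam the /hall.
  by rewrite !mul0r addr0 subr0.
- move=> ng na nb; apply/seteqP; split=> // w1 /fiber_trichotomy.
  by case.
Qed.
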